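(* Consider a structured problem in the class $\mathcal{SP}(m_f,\sigma_f,\bar\sigma_f,L,\delta)$ with $L(\cdot)=L\ge0$ constant, $\sigma_f=\bar\sigma_f=0$, $\delta(y,x)=\frac M\rho\|y-x\|^\rho$ for some $\rho\in[1,2)$ and $M\ge0$, and $Q$ bounded. Then the modified method of Method S with $\lambda_k=(k+1)/2$ and $\beta_k\equiv0$ generates a sequence $\{\hat x_k\}_{k\ge0}\subset Q$ satisfying $$f(\hat x_k)-f(x^* )\le\frac{2L\,\mathrm{Diam}(Q)^2}{k+4}+\frac{2^{\rho+1}M\,\mathrm{Diam}(Q)^\rho}{\rho(3-\rho)(k+2)^{\rho-1}}$$ for every $k\ge0$.
   Context: Setting. $E$ is a finite-dimensional real normed space with norm $\|\cdot\|$; $E^*$ is its dual, with pairing $\langle s,x\rangle$. $Q\subset E$ is a closed convex set, $\mathrm{Diam}(Q):=\sup_{x,y\in Q}\|x-y\|$, and $f:E\to\mathbb R\cup\{+\infty\}$ is a lower-semicontinuous (lsc) convex function with $Q\subset \mathrm{dom} f$. The problem $\min_{x\in Q}f(x)$ is assumed to have an optimal solution; $x^*\in Q$ denotes one. A prox-function $d:E\to\mathbb R\cup\{+\infty\}$ is fixed: $d$ is nonnegative, continuously differentiable and strongly convex on $Q$ ($Q\subset\mathrm{dom}\,d$) with constant $\sigma_d>0$ with respect to $\|\cdot\|$, and $d(x_0)=\min_{x\in Q}d(x)=0$ for its unique minimizer $x_0\in Q$. For $x,y\in Q$: $l_d(y;x):=d(y)+\langle\nabla d(y),x-y\rangle$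 and $\xi(y,x):=d(x)-l_d(y;x)$ (Bregman distance). For an lsc convex $\psi:E\to\mathbb R\cup\{+\infty\}$ with $Q\subset\mathrm{dom}\,\psi$, $\sigma(\psi):=\{\tau\ge0:\psi(x)-\tau d(x)\text{ is an lsc convex function on }Q\}$. Class $\mathcal{SP}(m_f,\sigma_f,\bar\sigma_f,L,\delta)$: problems $\min_{x\in Q}f(x)$ for which the following are given. For each $y\in Q$, $m_f(y;\cdot):E\to\mathbb R\cup\{+\infty\}$ is an lsc convex function (with $Q$ in its domain) with $m_f(y;x)\le f(x)$ for all $x\in Q$; $\sigma_f\ge0$ satisfies $\sigma_f\in\sigma(f)\cap\bigcap_{y\in Q}\sigma(m_f(y;\cdot))$; $\bar\sigma_f\in[0,\sigma_f]$; $L(\cdot)\ge0$ is a function on $Q$; $\delta(y,\cdot)$ is a nonnegative convex function on $Q$ for each $y\in Q$; and $$f(x)\le[m_f(y;x)-\bar\sigma_f\xi(y,x)]+\tfrac{L(y)}2\|y-x\|^2+\delta(y,x)\quad\forall x,y\in Q.$$ Subproblems $\min_{x\in Q}\{m_f(y;x)+\langle s,x\rangle+\beta d(x)\}$ ($\beta\ge0$, $s\in E^*$) are assumed solvable. Parameters. Weight parameters $\lambda_k>0$ ($k\ge0$); scaling parameters $\beta_k\ge0$ ($k\ge-1$), nondecreasing in $k$. $S_k:=\sum_{i=0}^k\lambda_i$, $S_{-1}:=0$. Property 2 for a coupled sequence of functions $\{(\varphi_k(x),\psi_k(x))\}_{k\ge-1}$ (associated with $\{\lambda_k\},\{\beta_k\}$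 and test points $\{x_k\}_{k\ge0}$), with $z_k:=\mathrm{argmin}_{x\in Q}\varphi_k(x)$, $w_k:=\mathrm{argmin}_{x\in Q}\psi_k(x)$ (minimizers assumed to exist; $z_k,w_k$ are chosen minimizers): (B0) $\varphi_k(x)\ge\psi_k(x)$ for all $x\in Q$, $k\ge -1$. (B1) $\psi_{-1}(w_{-1})=0$ and $z_{-1}=w_{-1}=x_0$. (B2) For all $k\ge-1$, $x\in Q$: $\psi_{k+1}(x)\ge\varphi_k(z_k)+\lambda_{k+1}m_f(x_{k+1};x)+\beta_{k+1}d(x)-\beta_kl_d(z_k;x)+S_k\sigma_f\xi(z_k,x)$. (B3) For all $k\ge-1$: $\psi_k(w_k)\le\min_{x\in Q}\{\sum_{i=0}^k\lambda_im_f(x_i;x)+\beta_kl_d(z_k;x)-S_k\sigma_f\xi(z_k,x)\}$. Method S, modified variant. With a coupled sequence $\{(\varphi_k,\psi_k)\}_{k\ge-1}$ satisfying Property 2: set $x_0:=z_{-1}:=w_{-1}:=\mathrm{argmin}_{x\in Q}d(x)$, $z_0:=\mathrm{argmin}_{x\in Q}\varphi_0(x)$, $\hat x_0:=w_0:=\mathrm{argmin}_{x\in Q}\psi_0(x)$. For $k\ge0$ set $x_{k+1}:=\frac{S_k\hat x_k+\lambda_{k+1}z_k}{S_{k+1}}$, $z_{k+1}:=\mathrm{argmin}_{x\in Q}\varphi_{k+1}(x)$, $w_{k+1}:=\mathrm{argmin}_{x\in Q}\psi_{k+1}(x)$, $\hat x_{k+1}:=\frac{S_k\hat x_k+\lambda_{k+1}w_{k+1}}{S_{k+1}}$.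 *)

(* Defs.v *)
From HB Require Import structures.
From mathcomp Require Import all_boot all_order all_algebra.
From mathcomp Require Import all_classical all_reals all_analysis.

Set Implicit Arguments.
Unset Strict Implicit.
Unset Printing Implicit Defensive.

Import Order.TTheory GRing.Theory Num.Theory.
Import numFieldNormedType.Exports.

Local Open Scope classical_set_scope.
Local Open Scope ring_scope.

(* Functions into R u {+oo} are functions into \bar R that avoid -oo.
   The elements of the dual space E* are the linear functionals
   {linear E -> R^o}: all of them are continuous, since E is always assumed
   to be finite-dimensional. *)

Definition finite_dimensional (R : realType) (E : normedModType R) : Prop :=
  exists (n : nat) (e : 'I_n -> E),
    forall v : E, exists c : 'I_n -> R, v = \sum_(i < n) c i *: e i.

Section ConvexProblem.
Context {R : realType} {E : normedModType R}.
Implicit Types (Q : set E) (f g d : E -> \bar R).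

Definition Diam Q : \bar R :=
  ereal_sup [set (`|p.1 - p.2|)%:E | p in Q `*` Q].

Definition avoids_ninfty g : Prop := forall x, g x != -oo%E.

Definition dom g : set E := [set x | (g x < +oo)%E].

Definition is_argmin Q g (u : E) : Prop :=
  Q u /\ forall x, Q x -> (g u <= g x)%E.

Definition lsc_on Q g : Prop := lower_semicontinuous (g : subspace Q -> \bar R).

Definition econvex_on Q g : Prop :=
  forall x y (t : R), Q x -> Q y -> 0 <= t <= 1 ->
    (g (t *: x + (1 - t) *: y)%R <= t%:E * g x + (1 - t)%:E * g y)%E.

Record lsc_convex g : Prop := LscConvex {
  lscc_ninfty : avoids_ninfty g;
  lscc_lsc : lower_semicontinuous g;
  lscc_convex : econvex_on setT g }.

Definition strongly_convex_on Q (sigma : R) g : Prop :=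
  forall x y (t : R), Q x -> Q y -> 0 <= t <= 1 ->
    (g (t *: x + (1 - t) *: y)%R <=
       t%:E * g x + (1 - t)%:E * g y
       - (sigma / 2 * t * (1 - t) * `|x - y| ^+ 2)%R%:E)%E.

(* l_d(y; x), for the gradient map grad = nabla d *)
Definition lin_d d (grad : E -> {linear E -> R^o}) (y x : E) : \bar R :=
  (d y + (grad y (x - y)%R : R)%:E)%E.

(* xi(y, x) *)
Definition bregman d (grad : E -> {linear E -> R^o}) (y x : E) : \bar R :=
  (d x - lin_d d grad y x)%E.

(* Differentiability on Q is understood relatively to Q, which may have empty
   interior and outside of which d may be +oo: the increments are taken in Q.
   The values <nabla d(y), x - y> for x, y in Q, the only ones entering lin_d
   and bregman, are then uniquely determined by d. The second clause is the
   continuity on Q of nabla d for the dual norm. *)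
Definition C1_on Q d (grad : E -> {linear E -> R^o}) : Prop :=
  (forall y, Q y -> forall e : R, 0 < e ->
     \forall x \near within Q (nbhs y),
       (`|d x - lin_d d grad y x| <= (e * `|x - y|)%:E)%E) /\
  (forall y, Q y -> forall e : R, 0 < e ->
     \forall x \near within Q (nbhs y),
       forall h : E, `|grad x h - grad y h| <= e * `|h|).

Record prox_function Q d (grad : E -> {linear E -> R^o})
    (sigma_d : R) (x0 : E) : Prop := ProxFunction {
  prox_ninfty : avoids_ninfty d;
  prox_dom : Q `<=` dom d;
  prox_ge0 : forall x, Q x -> (0 <= d x)%E;
  prox_C1 : C1_on Q d grad;
  prox_sigma_gt0 : 0 < sigma_d;
  prox_strongly_convex : strongly_convex_on Q sigma_d d;
  prox_argmin : is_argmin Q d x0;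
  prox_unique : forall u, is_argmin Q d u -> u = x0;
  prox_min0 : d x0 = 0%E }.

(* sigma(psi) *)
Definition sigma_set Q d (psi : E -> \bar R) : set R :=
  [set tau : R | 0 <= tau /\
     let g := fun x => (psi x - tau%:E * d x)%E in
     lsc_on Q g /\ econvex_on Q g].

(* m y x stands for m_f(y; x) *)
Record SP_class Q f d (grad : E -> {linear E -> R^o}) (m : E -> E -> \bar R)
    (sigma_f bsigma_f : R) (L : E -> R) (delta : E -> E -> R) : Prop :=
  SPClass {
  SP_m_lsc_convex : forall y, Q y -> lsc_convex (m y);
  SP_m_dom : forall y, Q y -> Q `<=` dom (m y);
  SP_m_le : forall y x, Q y -> Q x -> (m y x <= f x)%E;
  SP_sigma_ge0 : 0 <= sigma_f;
  SP_sigma_f : sigma_set Q d f sigma_f;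
  SP_sigma_m : forall y, Q y -> sigma_set Q d (m y) sigma_f;
  SP_bsigma : 0 <= bsigma_f <= sigma_f;
  SP_L_ge0 : forall y, Q y -> 0 <= L y;
  SP_delta_ge0 : forall y x, Q y -> Q x -> 0 <= delta y x;
  SP_delta_convex : forall y, Q y -> convex_function Q (delta y);
  SP_upper : forall x y, Q x -> Q y ->
    (f x <= (m y x - bsigma_f%:E * bregman d grad y x)
            + (L y / 2 * `|y - x| ^+ 2)%R%:E + (delta y x)%:E)%E }.

Definition subproblems_solvable Q d (m : E -> E -> \bar R) : Prop :=
  forall (y : E) (s : {linear E -> R^o}) (beta : R), Q y -> 0 <= beta ->
    exists u, is_argmin Q
      (fun x => (m y x + (s x : R)%:E + beta%:E * d x)%E) u.

(* Sequences indexed by k >= -1 (beta, phi, psi, z, w) are shifted by one: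
   their j-th term is the one of index j - 1 in the usual numbering. The
   sequences lambda, x, xhat start at 0 and are not shifted.
   Accordingly wsum lambda j = S_{j-1}, and wsum lambda 0 = S_{-1} = 0. *)
Definition wsum (lambda : nat -> R) (j : nat) : R := \sum_(i < j) lambda i.

Record property2 Q d (grad : E -> {linear E -> R^o}) (m : E -> E -> \bar R)
    (sigma_f : R) (x0 : E) (lambda beta : nat -> R)
    (phi psi : nat -> E -> \bar R) (x z w : nat -> E) : Prop := Property2 {
  P2_z : forall j, is_argmin Q (phi j) (z j);
  P2_w : forall j, is_argmin Q (psi j) (w j);
  P2_B0 : forall j u, Q u -> (psi j u <= phi j u)%E;
  P2_B1 : psi 0%N (w 0%N) = 0%E /\ z 0%N = x0 /\ w 0%N = x0;
  P2_B2 : forall j u, Q u ->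
    (phi j (z j) + (lambda j)%:E * m (x j) u + (beta j.+1)%:E * d u
       - (beta j)%:E * lin_d d grad (z j) u
       + (wsum lambda j * sigma_f)%R%:E * bregman d grad (z j) u
     <= psi j.+1 u)%E;
  P2_B3 : forall j,
    (psi j (w j) <=
     ereal_inf [set (\sum_(i < j) (lambda i)%:E * m (x i) u
                     + (beta j)%:E * lin_d d grad (z j) u
                     - (wsum lambda j * sigma_f)%R%:E
                       * bregman d grad (z j) u)%E | u in Q])%E }.

(* xh stands for \hat x *)
Record modified_method_S Q d (grad : E -> {linear E -> R^o})
    (m : E -> E -> \bar R) (sigma_f : R) (x0 : E) (lambda beta : nat -> R)
    (phi psi : nat -> E -> \bar R) (x xh z w : nat -> E) : Prop :=
  ModifiedMethodS {
  MS_property2 : property2 Q d grad m sigma_f x0 lambda beta phi psi x z w;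
  MS_x0 : x 0%N = x0;
  MS_xh0 : xh 0%N = w 1%N;
  MS_xS : forall k, x k.+1 =
    (wsum lambda k.+2)^-1 *:
      (wsum lambda k.+1 *: xh k + lambda k.+1 *: z k.+1);
  MS_xhS : forall k, xh k.+1 =
    (wsum lambda k.+2)^-1 *:
      (wsum lambda k.+1 *: xh k + lambda k.+1 *: w k.+2) }.

End ConvexProblem.

(* Main.v *)
Require Import Defs.
From HB Require Import structures.
From mathcomp Require Import all_boot all_order all_algebra.
From mathcomp Require Import all_classical all_reals all_analysis.
From mathcomp Require Import ring lra.

Set Implicit Arguments.
Unset Strict Implicit.
Unset Printing Implicit Defensive.

Import Order.TTheory GRing.Theory Num.Theory.
Import numFieldNormedType.Exports.

Local Open Scope classical_set_scope.
Local Open Scope ring_scope.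

(** With [beta = 0] and [sigma_f = 0] the coupled sequence telescopes:
    [psi_(k+1) >= psi_k(w_k) + lambda_(k+1) m_f(x_(k+1); .)] on [Q].  Since
    [x_(k+1)] and [xhat_(k+1)] are the averages of [xhat_k] with [z_k] and
    [w_(k+1)], they differ by at most [(lambda_(k+1) / S_(k+1)) Diam Q], so that
    convexity of [m_f] and the upper model give by induction
    [S_k f(xhat_k) <= psi_k(w_k) + sum_(i <= k) S_i g(lambda_i / S_i * Diam Q)]
    with [g(t) = L/2 t^2 + M/rho t^rho], while (B3) gives
    [psi_k(w_k) <= S_k f(xstar)].  For [lambda_i = (i+1)/2] one has
    [S_i = (i+1)(i+2)/4] and [lambda_i / S_i = 2/(i+2)], and it remains to bound
    two elementary sums. *)

(** * Convexity and diameter of the feasible set *)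

Lemma convex_set_segment (R : realType) (E : normedModType R) (Q : set E)
    (t : R) (a b : E) :
  convex_set Q -> 0 <= t <= 1 -> Q a -> Q b -> Q (t *: a + (1 - t) *: b).
Proof.
move=> cQ /andP[t0 t1] Qa Qb.
have /= := cQ a b (Itv01 t0 t1); rewrite !inE; exact.
Qed.

(** Nonemptiness rules out the supremum [-oo], and a norm bound [B] caps it by [B + B], so the
    extended-real diameter can be traded for a real [D]. *)
Lemma bounded_set_Diam (R : realType) (E : normedModType R) (Q : set E) :
  Q !=set0 -> bounded_set Q ->
  exists D : R, [/\ 0 <= D, Diam Q = D%:E &
    forall a b, Q a -> Q b -> `|a - b| <= D].
Proof.
move=> [q Qq] /= /ex_strict_bound_gt0 [B B0 bB].
have QB a : Q a -> `|a| < B by exact: bB.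
have sup_ge a b : Q a -> Q b -> (`|a - b|%:E <= Diam Q)%E.
  by move=> Qa Qb; apply: ereal_sup_ubound; exists (a, b).
have Diam_ge0 : (0 <= Diam Q)%E.
  by apply: le_trans (sup_ge q q Qq Qq); rewrite lee_fin.
have Diam_le : (Diam Q <= (B + B)%:E)%E.
  apply: ge_ereal_sup => _ [[a b] [/= Qa Qb] <-].
  by rewrite lee_fin (le_trans (ler_normB _ _))// lerD ?ltW ?QB.
have Diam_fin : Diam Q \is a fin_num.
  by rewrite ge0_fin_numE// (le_lt_trans Diam_le) ?ltry.
exists (fine (Diam Q)); split; rewrite ?fine_ge0 ?fineK// => a b Qa Qb.
by rewrite -lee_fin fineK// sup_ge.
Qed.

(** * Gap estimate for arbitrary positive weights and a monotone error modulus [g] *)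

Section ModifiedMethodGap.
Context {R : realType} {E : normedModType R}.
Variables (Q : set E) (f d : E -> \bar R) (grad : E -> {linear E -> R^o}).
Variables (m : E -> E -> \bar R) (x0 : E) (lambda : nat -> R).
Variables (phi psi : nat -> E -> \bar R) (x xh z w : nat -> E).
Variables (g : R -> R) (D : R).

Local Notation S := (wsum lambda).

Hypothesis Q_convex : convex_set Q.
Hypothesis Q_diam : forall a b, Q a -> Q b -> `|a - b| <= D.
Hypothesis lambda_gt0 : forall k, 0 < lambda k.
Hypothesis f_fin : forall u, Q u -> f u \is a fin_num.
Hypothesis m_fin : forall y u, Q y -> Q u -> m y u \is a fin_num.
Hypothesis m_convex : forall y, Q y -> econvex_on Q (m y).
Hypothesis m_le : forall y u, Q y -> Q u -> (m y u <= f u)%E.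
Hypothesis f_le :
  forall y u, Q y -> Q u -> (f u <= m y u + (g `|y - u|)%:E)%E.
Hypothesis g_homo : {in Num.nneg &, {homo g : s t / s <= t}}.
Hypothesis method :
  modified_method_S Q d grad m 0 x0 lambda (fun=> 0) phi psi x xh z w.

Let P2 := MS_property2 method.

Let Qz j : Q (z j). Proof. by have [] := P2_z P2 j. Qed.
Let Qw j : Q (w j). Proof. by have [] := P2_w P2 j. Qed.

Let Qx0 : Q (x 0).
Proof. by rewrite (MS_x0 method); have [_ [<- _]] := P2_B1 P2. Qed.

Let wsumS k : S k.+1 = S k + lambda k.
Proof. by rewrite /wsum big_ord_recr. Qed.

Let wsum_ge0 k : 0 <= S k.
Proof. by apply: sumr_ge0 => i _; exact: ltW. Qed.

Let wsum_gt0 k : 0 < S k.+1.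
Proof. by rewrite wsumS ltr_wpDl. Qed.

(** Both updates have this shape, with index [k.+1]: [x k.+1] averages [xh k] with [z k.+1], and
    [xh k.+1] averages [xh k] with [w k.+2]. *)
Let mean k (a b : E) := (S k.+1)^-1 *: (S k *: a + lambda k *: b).

Let meanE k a b :
  mean k a b = (S k / S k.+1) *: a + (1 - S k / S k.+1) *: b.
Proof.
have S0 : S k.+1 != 0 by rewrite gt_eqF.
rewrite /mean scalerDr !scalerA -[X in X - _](divff S0) -mulrBl.
by rewrite [in X in X - _]wsumS addrAC subrr add0r ![_^-1 * _]mulrC.
Qed.

Let weight_itv k : 0 <= S k / S k.+1 <= 1.
Proof.
rewrite divr_ge0 ?wsum_ge0// ler_pdivrMr// mul1r wsumS lerDl.
exact: ltW.
Qed.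

Let Qmean k a b : Q a -> Q b -> Q (mean k a b).
Proof. by move=> Qa Qb; rewrite meanE; exact: convex_set_segment. Qed.

Let fine_m_convex k y a b : Q y -> Q a -> Q b ->
  S k.+1 * fine (m y (mean k a b)) <=
  S k * fine (m y a) + lambda k * fine (m y b).
Proof.
move=> Qy Qa Qb; have := m_convex Qy Qa Qb (weight_itv k).
rewrite -meanE -(fineK (m_fin Qy (Qmean k Qa Qb))) -(fineK (m_fin Qy Qa)).
rewrite -(fineK (m_fin Qy Qb)) -!EFinM -EFinD lee_fin.
rewrite -(ler_pM2l (wsum_gt0 k)) => /le_trans; apply.
have S0 : S k.+1 != 0 by rewrite gt_eqF.
have -> : lambda k = S k.+1 - S k by rewrite wsumS addrAC subrr add0r.
rewrite /=; move: S0; move: (S k.+1) (S k) (fine _) (fine _) => s t p q s0.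
by rewrite le_eqVlt; apply/orP; left; apply/eqP; field.
Qed.

Let fine_f_le y u t : Q y -> Q u -> `|y - u| <= t ->
  fine (f u) <= fine (m y u) + g t.
Proof.
move=> Qy Qu ht; have := f_le Qy Qu.
rewrite -(fineK (m_fin Qy Qu)) -(fineK (f_fin Qu)) -EFinD lee_fin => /le_trans.
apply; rewrite lerD2l g_homo// nnegrE//.
exact: le_trans ht.
Qed.

(** Evaluate (B2) at [w j.+1]; then (B0) and the minimality of [w j] replace [phi j (z j)] by the
    smaller [psi j (w j)]. Values of [psi] are not assumed finite, so the inequality stays in
    [\bar R]. *)
Let psi_rec j : Q (x j) ->
  (psi j (w j) + (lambda j * fine (m (x j) (w j.+1)))%:E <=
   psi j.+1 (w j.+1))%E.
Proof.
move=> Qx; apply: le_trans (P2_B2 P2 j (Qw j.+1)).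
(* In [\bar R] a zero factor annihilates even infinite values, so the prox terms vanish without any
   finiteness condition. *)
rewrite mulr0 !mul0e adde0 sube0 adde0 EFinM fineK ?m_fin//.
apply: leeD2r; apply: le_trans (P2_B0 P2 j (Qz j)).
by have [_] := P2_w P2 j; exact.
Qed.

(** By the index shift, [psi k.+1 (w k.+1)] is the minimum of the [k]-th estimate function.
    Membership of [xh k] is carried through the induction because it places [x k.+1] in [Q]. *)
Lemma modified_method_upper k : Q (xh k) /\
  ((S k.+1 * fine (f (xh k)))%:E <= psi k.+1 (w k.+1)
     + (\sum_(i < k.+1) S i.+1 * g (lambda i / S i.+1 * D))%:E)%E.
Proof.
elim: k => [|k [Qxh IH]].
  rewrite (MS_xh0 method); split; first exact: Qw.
  rewrite big_ord1/=.
  (* The first ratio [lambda 0 / S 1] is 1, so the first error term is [g D], which covers the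
     distance from [x 0] to [w 1]. *)
  have S1 : S 1 = lambda 0%N by rewrite /wsum big_ord1.
  have psi1 : ((lambda 0%N * fine (m (x 0) (w 1)))%:E <= psi 1 (w 1))%E.
    have := psi_rec Qx0.
    by have [-> _] := P2_B1 P2; rewrite add0e.
  apply: le_trans (leeD2r _ psi1); rewrite -EFinD lee_fin S1.
  rewrite divff ?gt_eqF// mul1r -mulrDr ler_pM2l// fine_f_le//.
  exact: Q_diam.
have Qx : Q (x k.+1) by rewrite (MS_xS method); exact: Qmean.
have Qxh' : Q (xh k.+1) by rewrite (MS_xhS method); exact: Qmean.
split => //; rewrite big_ord_recr/= EFinD addeA.
have r0 : 0 <= lambda k.+1 / S k.+2 by rewrite divr_ge0 ?wsum_ge0// ltW.
(* The two averages share the term in [xh k]; only [z k.+1 - w k.+2] survives in the difference. *)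
have dist : `|x k.+1 - xh k.+1| <= lambda k.+1 / S k.+2 * D.
  rewrite (MS_xS method) (MS_xhS method) -scalerBr opprD addrACA subrr add0r.
  rewrite -scalerBr scalerA mulrC normrZ ger0_norm// ler_wpM2l//.
  exact: Q_diam.
have fxh := fine_f_le Qx Qxh' dist.
(* After splitting by convexity, the model is raised to [f] at [xh k], to meet the induction
   hypothesis, but kept at [w k.+2], where [psi_rec] supplies it. *)
have mxh : S k.+2 * fine (m (x k.+1) (xh k.+1)) <=
    S k.+1 * fine (f (xh k)) + lambda k.+1 * fine (m (x k.+1) (w k.+2)).
  rewrite (MS_xhS method); apply: le_trans (fine_m_convex _ Qx Qxh (Qw _)) _.
  by rewrite lerD2r ler_wpM2l// fine_le ?m_fin ?f_fin ?m_le.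
have step : S k.+2 * fine (f (xh k.+1)) <=
    S k.+1 * fine (f (xh k)) + lambda k.+1 * fine (m (x k.+1) (w k.+2))
    + S k.+2 * g (lambda k.+1 / S k.+2 * D).
  apply: le_trans (lerD mxh (lexx _)); rewrite -mulrDr ler_pM2l//.
move: step; rewrite -lee_fin => /le_trans; apply.
rewrite EFinD; apply: leeD2r; rewrite EFinD.
apply: le_trans (leeD2r _ (psi_rec Qx)); rewrite addeAC.
exact: leeD2r IH.
Qed.

(** (B3) tested at [u], with each model bounded by [f], caps the minimum of [psi k.+1] by
    [S k.+1 * f u]; this is chained with the invariant. *)
Lemma modified_method_gap k u : Q u ->
  S k.+1 * (fine (f (xh k)) - fine (f u)) <=
  \sum_(i < k.+1) S i.+1 * g (lambda i / S i.+1 * D).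
Proof.
move=> Qu; have Qx j : Q (x j).
  case: j => [//|j]; rewrite (MS_xS method); apply: Qmean => //.
  by have [] := modified_method_upper j.
have psi_le : (psi k.+1 (w k.+1) <= (S k.+1 * fine (f u))%:E)%E.
  apply: le_trans (P2_B3 P2 k.+1) _; apply: ge_ereal_inf.
  eexists; first by exists u.
  rewrite mulr0 !mul0e adde0 sube0 /wsum mulr_suml -sumEFin.
  apply: lee_sum => i _; rewrite -(fineK (m_fin (Qx i) Qu)) -EFinM lee_fin.
  by rewrite ler_pM2l// fine_le ?m_fin ?f_fin ?m_le.
have [_ /le_trans /(_ (leeD2r _ psi_le))] := modified_method_upper k.
by rewrite -EFinD lee_fin mulrBr lerBlDl.
Qed.

End ModifiedMethodGap.

(** * Elementary sums for the linearly growing weights *)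

Section LinearWeights.
Variable R : realType.

Local Notation lambda := (fun k : nat => k.+1%:R / 2 : R).
Local Notation S := (wsum lambda).

Lemma wsum_linear k : S k = k%:R * k.+1%:R / 4.
Proof.
elim: k => [|k IH]; first by rewrite /wsum big_ord0 mul0r mul0r.
have -> : S k.+1 = S k + k.+1%:R / 2 by rewrite /wsum big_ord_recr.
by rewrite IH -!(natr1 k.+1) -!(natr1 k); field.
Qed.

Lemma step_linear k : lambda k / S k.+1 = 2 / k.+2%:R.
Proof.
rewrite wsum_linear; have k1 : k.+1%:R != 0 :> R by rewrite pnatr_eq0.
have k2 : k.+2%:R != 0 :> R by rewrite pnatr_eq0.
by move: k1 k2; move: (k.+1%:R) (k.+2%:R) => a b a0 b0; field; rewrite a0 b0.
Qed.

(** The summand is [(i+1)/(i+2)] and the bound is [(k+1)(k+2)/(k+4)], with equality at [k = 0]. In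
    the induction step the slack is an explicit nonnegative fraction. *)
Lemma sum_quadratic_error k :
  \sum_(i < k.+1) S i.+1 * (2 / i.+2%:R) ^+ 2 <= S k.+1 * (4 / (k%:R + 4)).
Proof.
elim: k => [|k IH].
  by rewrite big_ord1/= wsum_linear !add0r; lra.
rewrite big_ord_recr/=; apply: le_trans (lerD IH (lexx _)) _.
rewrite !wsum_linear -!(natr1 k.+2) -!(natr1 k.+1) -!(natr1 k).
have : 0 <= k%:R :> R by []; set t : R := k%:R => t0.
rewrite -subr_ge0.
set e := (X in 0 <= X).
have -> : e = (t + 1) * (t + 2) / ((t + 3) * (t + 4) * (t + 5)).
  by rewrite /e; field; lra.
by rewrite divr_ge0 ?mulr_ge0//; lra.
Qed.

(* Termwise [(i+1) (i+2)^(1-rho) <= (k+2)^(2-rho)]; since [rho >= 1], the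
   factor [2 / (3 - rho) >= 1] of the stated bound is pure slack. *)
Lemma sum_power_error (rho : R) k : 1 <= rho < 2 ->
  \sum_(i < k.+1) S i.+1 * (2 / i.+2%:R) `^ rho <=
  S k.+1 * (2 `^ (rho + 1) / ((3 - rho) * (k%:R + 2) `^ (rho - 1))).
Proof.
move=> /andP[rho1 rho2].
have k2 : k%:R + 2 = k.+2%:R :> R by rewrite -(natrD _ k 2) addn2.
(* Every real power is expressed through the [(rho - 1)]-th one, which [field] can then treat as an
   atom. *)
have pw (n : nat) : n.+2%:R `^ rho = n.+2%:R * n.+2%:R `^ (rho - 1) :> R.
  by rewrite mulr_powRB1//; lra.
have pw2 (n : nat) : n.+2%:R `^ (2 - rho) = n.+2%:R / n.+2%:R `^ (rho - 1) :> R.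
  rewrite (_ : 2 - rho = 1 - (rho - 1)); last by ring.
  by rewrite powRB ?powRr1// pnatr_eq0 implybT.
have pwgt0 (n : nat) : 0 < n.+2%:R `^ (rho - 1) :> R.
  by rewrite powR_gt0.
have term (i : 'I_k.+1) : S i.+1 * (2 / i.+2%:R) `^ rho <=
    2 `^ rho / 4 * k.+2%:R `^ (2 - rho).
  rewrite wsum_linear powRM ?invr_ge0// -(powR_inv1 (ler0n R i.+2)) -powRrM.
  rewrite mulN1r powRN (pw i).
  have le_i : i.+1%:R / i.+2%:R `^ (rho - 1) <= k.+2%:R `^ (2 - rho) :> R.
    apply: (@le_trans _ _ (i.+2%:R `^ (2 - rho))).
      by rewrite pw2 ler_wpM2r ?invr_ge0 ?powR_ge0// ler_nat.
    by rewrite ge0_ler_powR ?nnegrE ?ler_nat ?ltnS//; [lra|case: i].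
  apply: le_trans (ler_wpM2l _ le_i); last by rewrite divr_ge0 ?powR_ge0.
  have i2 : i.+2%:R != 0 :> R by rewrite pnatr_eq0.
  have := pwgt0 i; rewrite lt0r => /andP[P0 _].
  move: i2 P0; move: (i.+1%:R) (i.+2%:R) (_ `^ (rho - 1)) => a b c b0 c0.
  by rewrite le_eqVlt; apply/orP; left; apply/eqP; field; rewrite b0 c0.
apply: le_trans (ler_sum _ (fun i _ => term i)) _.
rewrite sumr_const card_ord -[leLHS]mulr_natl pw2 k2 wsum_linear.
rewrite (@powRD _ 2 rho 1) ?powRr1//; last by rewrite pnatr_eq0 implybT.
have := pwgt0 k; set P := _ `^ (rho - 1) => P0.
have := powR_gt0 rho (ltr0n R 2); set T := _ `^ rho => T0.
(* The [k.+1] copies of the uniform bound reassemble into [S k.+1] times [T / P]. *)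
have -> : k.+1%:R * (T / 4 * (k.+2%:R / P)) = k.+1%:R * k.+2%:R / 4 * (T / P) :> R.
  by ring.
rewrite ler_wpM2l ?divr_ge0 ?mulr_ge0//.
have -> : T * 2 / ((3 - rho) * P) = T / P * (2 / (3 - rho)).
  by rewrite invfM; ring.
have TP : 0 <= T / P by rewrite divr_ge0// ltW.
by rewrite ler_peMr// ler_pdivlMr; lra.
Qed.

End LinearWeights.

(** * Specialization of the modulus and of the weights *)

Theorem theorem5p7 (R : realType) (E : normedModType R)
    (Q : set E) (f : E -> \bar R) (xstar : E)
    (d : E -> \bar R) (grad_d : E -> {linear E -> R^o}) (sigma_d : R) (x0 : E)
    (m : E -> E -> \bar R) (L M rho : R)
    (phi psi : nat -> E -> \bar R) (x xh z w : nat -> E) :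
  finite_dimensional E ->
  closed Q -> convex_set Q -> bounded_set Q ->
  lsc_convex f -> Q `<=` dom f -> is_argmin Q f xstar ->
  prox_function Q d grad_d sigma_d x0 ->
  0 <= L -> 0 <= M -> 1 <= rho < 2 ->
  SP_class Q f d grad_d m 0 0 (fun=> L)
    (fun y u => M / rho * `|y - u| `^ rho) ->
  subproblems_solvable Q d m ->
  modified_method_S Q d grad_d m 0 x0
    (fun k => k.+1%:R / 2) (fun=> 0) phi psi x xh z w ->
  forall k : nat, Q (xh k) /\
    (f (xh k) - f xstar <=
       (2 * L / (k%:R + 4))%R%:E * Diam Q ^+ 2
       + (2 `^ (rho + 1) * M
            / (rho * (3 - rho) * (k%:R + 2) `^ (rho - 1)))%R%:E
         * poweR (Diam Q) rho)%E.
Proof.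
move=> _ _ cQ bQ lscf domf [Qxs fxs] _ L0 M0 rho12 SP _ MS k.
have /andP[rho1 rho2] := rho12.
have rho0 : 0 < rho by lra.
have [D [D0 DiamE Qdiam]] : exists D : R, [/\ 0 <= D, Diam Q = D%:E &
    forall a b, Q a -> Q b -> `|a - b| <= D].
  by apply: bounded_set_Diam => //; exists xstar.
have ffin u : Q u -> f u \is a fin_num.
  move=> Qu; rewrite fin_real// ltNye lscc_ninfty//=; exact: domf.
have mfin y u : Q y -> Q u -> m y u \is a fin_num.
  move=> Qy Qu; rewrite fin_real// ltNye.
  rewrite (lscc_ninfty (SP_m_lsc_convex SP Qy))/=; exact: SP_m_dom SP _ Qy _ Qu.
(* The modulus gathers the quadratic term and [delta] of the upper model. *)
pose g t := L / 2 * t ^+ 2 + M / rho * t `^ rho.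
have ghomo : {in Num.nneg &, {homo g : s t / s <= t}}.
  move=> s t; rewrite !nnegrE => s0 t0 st; rewrite /g lerD// ler_wpM2l//.
  - by rewrite divr_ge0.
  - by rewrite lerXn2r ?nnegrE.
  - by rewrite divr_ge0// ltW.
  - by rewrite ge0_ler_powR ?nnegrE// ltW.
have fle y u : Q y -> Q u -> (f u <= m y u + (g `|y - u|)%:E)%E.
  move=> Qy Qu; apply: le_trans (SP_upper SP Qu Qy) _.
  by rewrite mul0e sube0 -addeA -EFinD.
have lambda0 i : 0 < i.+1%:R / 2 :> R by rewrite divr_gt0.
have mconv y : Q y -> econvex_on Q (m y).
  by move=> Qy a b t _ _; apply: lscc_convex (SP_m_lsc_convex SP Qy) _ _ _ _ _.
have mle y u : Q y -> Q u -> (m y u <= f u)%E.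
  by move=> Qy Qu; exact: (SP_m_le SP Qy Qu).
have [Qxh _] := modified_method_upper cQ Qdiam lambda0 ffin mfin mconv mle fle
  ghomo MS k.
split=> //.
have gap := modified_method_gap cQ Qdiam lambda0 ffin mfin mconv mle fle
  ghomo MS k Qxs.
rewrite DiamE poweR_EFin -(fineK (ffin _ Qxh)) -(fineK (ffin _ Qxs)).
rewrite -EFinB -!EFin_expe -!EFinM -EFinD lee_fin.
have S0 : 0 < wsum (fun k => k.+1%:R / 2 : R) k.+1.
  by rewrite wsum_linear divr_gt0 ?mulr_gt0.
(* The bound is compared after multiplication by [S k.+1], the form in which the gap and both sums
   are stated. *)
rewrite -(ler_pM2l S0); apply: le_trans gap _.
under eq_bigr => i _ do rewrite step_linear /g exprMn powRM// mulrDr.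
rewrite big_split/= mulrDr; apply: lerD.
  (* Scaling by [L / 2 * D ^+ 2] turns the factor [4 / (k + 4)] into [2 * L / (k + 4) * D ^+ 2]. *)
  have := ler_wpM2l (mulr_ge0 (divr_ge0 L0 (ler0n R 2)) (sqr_ge0 D))
    (sum_quadratic_error R k).
  rewrite mulr_sumr; move: (wsum _ k.+1) => Sk.
  have -> : L / 2 * D ^+ 2 * (Sk * (4 / (k%:R + 4))) =
      Sk * (2 * L / (k%:R + 4) * D ^+ 2) by field; rewrite lt0r_neq0// ltr_wpDl.
  congr (_ <= _); apply: eq_bigr => i _.
  by move: (wsum _ _) (2 / _) => s t; ring.
have := ler_wpM2l (mulr_ge0 (divr_ge0 M0 (ltW rho0)) (powR_ge0 D rho))
  (sum_power_error k rho12).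
rewrite mulr_sumr; move: (wsum _ k.+1) => Sk.
have P0 : (k%:R + 2) `^ (rho - 1) != 0 :> R.
  by rewrite lt0r_neq0// powR_gt0// ltr_wpDl.
have r3 : 3 - rho != 0 by lra.
move: P0; move: (_ `^ (rho - 1)) => P P0.
have -> : M / rho * D `^ rho * (Sk * (2 `^ (rho + 1) / ((3 - rho) * P))) =
    Sk * (2 `^ (rho + 1) * M / (rho * (3 - rho) * P) * D `^ rho).
  by field; rewrite P0 r3 lt0r_neq0.
congr (_ <= _); apply: eq_bigr => i _.
by move: (wsum _ _) (_ `^ rho) (_ `^ rho) => s t u; ring.
Qed.
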